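(* Let $(\lambda_k)_{k\ge1}$ be a strictly increasing sequence of positive real numbers such that $\lambda_k\sim k^2$ as $k\to+\infty$. Let $H$ be a real separable (infinite-dimensional) Hilbert space with orthonormal basis $(e_k)_{k\ge1}$, and let $A:D(A)\subset H\to H$ be the self-adjoint operator with $Ae_k=-\lambda_ke_k$, $k\ge1$, and $D(A)=\{x\in H:\sum_{k\ge1}\langle x,e_k\rangle^2\lambda_k^2<\infty\}$. For $f\in C^2_b(H)$ let $$ R(1,L)f(x)=\int_0^\infty e^{-t}(P_tf)(x)\,dt,\qquad P_tf(x)=\int_H f(e^{tA}x+y)\,N(0,Q_t)(dy),\qquad x\in H, $$ where $Q_t=\int_0^te^{2sA}\,ds=(-2A)^{-1}(I-e^{2tA})$, $t\ge0$. Then $$ \sup_{\substack{f\in C^2_b(H)\\ \|f\|_\infty\le1}}\ \big|(-A)^{1/2}D(R(1,L)f)(0)\big|_H=\infty. $$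
   Context: $\lambda_k\sim k^2$ means $\lambda_k/k^2\to1$ as $k\to\infty$ (in particular $\sum_k 1/\lambda_k<\infty$, so $A^{-1}$ is trace class). $C^2_b(H)$ is the space of bounded functions $f:H\to\mathbb{R}$ that are twice Fr\'echet differentiable on $H$ with first and second derivatives bounded and continuous; $\|f\|_\infty=\sup_{x\in H}|f(x)|$. $Df(x)\in H$ is the Fr\'echet derivative at $x$, identified with an element of $H$ by Riesz representation. $e^{tA}$ is the semigroup with $e^{tA}e_k=e^{-t\lambda_k}e_k$; $(-A)^{1/2}$ is the operator with $(-A)^{1/2}e_k=\sqrt{\lambda_k}\,e_k$ on its natural domain $D((-A)^{1/2})=\{x\in H:\sum_k\lambda_k\langle x,e_k\rangle^2<\infty\}$. For a symmetric non-negative definite trace class operator $Q$ on $H$, $N(0,Q)$ is the centered Gaussian measure on $H$, i.e. the unique Borel probability measure with $\int_He^{i\langle x,h\rangle}N(0,Q)(dx)=e^{-\frac12\langle Qh,h\rangle}$ for all $h\in H$. It is known that for $f\in C^2_b(H)$ one has $R(1,L)f\in C^2_b(H)$ and $D(R(1,L)f)(x)\in D((-A)^{1/2})$ for all $x\in H$, so the quantity in the claim is well defined. *)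

(* Defs.v *)
From HB Require Import structures.
From mathcomp Require Import all_boot all_order all_algebra.
From mathcomp Require Import sesquilinear.
From mathcomp Require Import all_classical all_reals all_analysis.
Set Implicit Arguments.
Unset Strict Implicit.
Unset Printing Implicit Defensive.
Import Order.TTheory GRing.Theory Num.Theory.
Import numFieldNormedType.Exports.
Local Open Scope classical_set_scope.
Local Open Scope ring_scope.

Notation borel H := (g_sigma_algebraType (@open H)).

Section Hilbert.
Variables (R : realType) (H : completeNormedModType R).

(* A complete normed space is a Hilbert space when its norm comes from an
   inner product (for a real space, a positive definite symmetric form). *)
Definition hilbert_dot (ip : {dot H for (@idfun R)}) : Prop :=
  forall x : H, ip x x = `|x| ^+ 2.

Variable ip : {dot H for (@idfun R)}.

Definition orthonormal_basis (e : nat -> H) : Prop :=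
  (forall i j, ip (e i) (e j) = (i == j)%:R) /\
  (forall x, series (fun k => ip x (e k) *: e k) @ \oo --> x).

(* The operator with eigenvalues c k along the orthonormal basis e; its natural
   domain is {x | sum_k (c k * <x, e k>)^2 < +oo}, which is exactly the set of
   the x at which the series converges (lim is a constant dummy elsewhere). *)
Definition diag_op (e : nat -> H) (c : nat -> R) (x : H) : H :=
  lim (series (fun k => (c k * ip x (e k)) *: e k) @ \oo).

(* Riesz representative of the Frechet derivative (0 if f is not Frechet
   differentiable at x). *)
Definition grad (f : H -> R) (x : H) : H :=
  xget 0 [set g | differentiable f x /\ forall v, 'd f x v = ip g v].

(* The second derivative is the Frechet derivative of grad f : H -> H; its
   boundedness and continuity are meant for the operator norm. *)
Definition C2b (f : H -> R) : Prop :=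
  [/\ bounded_fun f,
      (forall x, differentiable f x) /\
        (forall x, differentiable (grad f) x),
      bounded_fun (grad f) /\ continuous (grad f),
      exists M : R, forall x v, `|'d (grad f) x v| <= M * `|v|
    & forall (x : H) (eps : R), 0 < eps ->
        \forall y \near x,
          forall v, `|'d (grad f) y v - 'd (grad f) x v| <= eps * `|v| ].

Definition sup_norm (f : H -> R) : \bar R :=
  ereal_sup (range (fun x => `|f x|%:E)).

(* mu = N(0, Q): real and imaginary parts of
   int e^{i <x, h>} mu(dx) = e^{- <Q h, h> / 2}. *)
Definition is_gaussian (mu : probability (borel H) R) (Q : H -> H) : Prop :=
  forall h : H,
    \int[mu]_x cos (ip (x : H) h) = expR (- (2^-1 * ip (Q h) h)) /\
    \int[mu]_x sin (ip (x : H) h) = 0.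

(* A is the self-adjoint operator with A (e k) = - lambda k * e k, so that
   functions of A are diagonal in the basis e. *)
Variables (e : nat -> H) (lambda : nat -> R).

Definition expA (t : R) : H -> H :=
  diag_op e (fun k => expR (- t * lambda k)).

Definition sqrt_negA : H -> H := diag_op e (fun k => Num.sqrt (lambda k)).

Definition inv_neg2A : H -> H := diag_op e (fun k => (2 * lambda k)^-1).

Definition Qt (t : R) (x : H) : H := inv_neg2A (x - expA (2 * t) x).

Variable N : R -> probability (borel H) R.

Definition Pt (t : R) (f : H -> R) (x : H) : R :=
  \int[N t]_y f (expA t x + (y : H)).

Definition resolvent1 (f : H -> R) (x : H) : R :=
  \int[lebesgue_measure]_(t in `[0, +oo[) (expR (- t) * Pt t f x).

End Hilbert.

(* Main.v *)
(* The supremum is already infinite over trigonometric polynomials, for which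
   the Gaussian integrals are given by the characteristic function of N(0, Q_t).
   Along a subsequence with lambda_{k_{i+1}} >= 5 lambda_{k_i}, put
   theta_i = sqrt(lambda_{k_i}) <x, e_{k_i}> and
     f = sum_{i < n} sin^3 theta_i prod_{j < i} cos^2 theta_j.
   Since |sin^3| <= 1 - cos^2, the sum telescopes to |f| <= 1. By independence
   and parity, the k_i-th component of D(P_t f)(0) only involves the i-th
   summand and is nonnegative. For t in [1/lambda_{k_i}, 2/lambda_{k_i}] the
   slower modes have hardly moved, so the cosine factors have mean at least 1/2
   and the component is at least a constant times
   sqrt(lambda_{k_i}). Integrating over this window, each of the n components
   of (-A)^{1/2} D(R(1,L)f)(0) is at least a constant independent of n. *)
From HB Require Import structures.
Require Import Defs.
From mathcomp Require Import all_boot all_order all_algebra.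
From mathcomp Require Import sesquilinear.
From mathcomp Require Import all_classical all_reals all_analysis.
From mathcomp Require Import measurable_realfun ring lra.
Import Order.TTheory GRing.Theory Num.Theory.
Import numFieldNormedType.Exports.
Local Open Scope classical_set_scope.
Local Open Scope ring_scope.
Set Implicit Arguments.
Unset Strict Implicit.
Unset Printing Implicit Defensive.

(** * Inner products and diagonal operators *)

Section HilbertGeometry.
Variables (R : realType) (H : completeNormedModType R).
Variable ip : {dot H for (@idfun R)}.
Hypothesis hip : hilbert_dot ip.

Lemma ipC x y : ip x y = ip y x.
Proof. by rewrite hermC expr0 mul1r. Qed.

Lemma ipDl x y z : ip (x + y) z = ip x z + ip y z.
Proof. exact: linearDl. Qed.

Lemma ipZl a x z : ip (a *: x) z = a * ip x z.
Proof. exact: linearZl_LR. Qed.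

Lemma ipNl x z : ip (- x) z = - ip x z.
Proof. exact: linearNl. Qed.

Lemma ip0l z : ip 0 z = 0.
Proof. exact: linear0l. Qed.

Lemma ipDr x y z : ip z (x + y) = ip z x + ip z y.
Proof. by rewrite ipC ipDl !(ipC _ z). Qed.

Lemma ipZr a x z : ip z (a *: x) = a * ip z x.
Proof. by rewrite ipC ipZl (ipC x). Qed.

Lemma ipNr x z : ip z (- x) = - ip z x.
Proof. by rewrite ipC ipNl (ipC x). Qed.

Lemma ip_suml I (r : seq I) (P : pred I) (F : I -> H) z :
  ip (\sum_(i <- r | P i) F i) z = \sum_(i <- r | P i) ip (F i) z.
Proof. exact: linear_sumlz. Qed.

Lemma ip_sumr I (r : seq I) (P : pred I) (F : I -> H) z :
  ip z (\sum_(i <- r | P i) F i) = \sum_(i <- r | P i) ip z (F i).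
Proof. by rewrite ipC ip_suml; apply: eq_bigr => i _; rewrite ipC. Qed.

Lemma Cauchy_Schwarz x y : `|ip x y| <= `|x| * `|y|.
Proof.
have [->|y0] := eqVneq y 0; first by rewrite ipC ip0l !normr0 mulr0.
have ny : 0 < `|y| by rewrite normr_gt0.
rewrite -(@ler_pXn2r _ 2) ?nnegrE ?mulr_ge0// real_normK ?num_real//.
rewrite exprMn.
set b := ip x y.
have : 0 <= ip (`|y| ^+ 2 *: x - b *: y) (`|y| ^+ 2 *: x - b *: y).
  by rewrite hip sqr_ge0.
rewrite !(ipDl, ipNl, ipDr, ipNr, ipZl, ipZr) !hip (ipC y) -/b => h.
have {}h : 0 <= `|y| ^+ 2 * (`|x| ^+ 2 * `|y| ^+ 2 - b ^+ 2).
  by move: h; congr (0 <= _); ring.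
by rewrite pmulr_rge0 ?exprn_gt0// subr_ge0 in h.
Qed.

Lemma ip_continuous h : continuous (ip^~ h : H -> R).
Proof.
move=> x; apply/cvgrPdist_lt => eps eps0.
near=> y.
rewrite -ipNl -ipDl.
apply: le_lt_trans (Cauchy_Schwarz _ _) _.
apply: (@le_lt_trans _ _ (`|x - y| * (`|h| + 1))).
  by rewrite ler_wpM2l// lerDl.
rewrite -ltr_pdivlMr; last by rewrite ltr_wpDl.
near: y; apply: (@cvgr_dist_lt _ _ _ (nbhs x) _ id x) => //.
by rewrite divr_gt0// ltr_wpDl.
Unshelve. all: by end_near. Qed.

Lemma ip_inj x y : (forall v, ip x v = ip y v) -> x = y.
Proof.
move=> xy; apply/eqP; rewrite -subr_eq0 -normr_eq0 -sqrf_eq0 -hip.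
by rewrite ipDl xy -ipDl subrr ip0l.
Qed.

Variable e : nat -> H.
Hypothesis he : orthonormal_basis ip e.

Lemma ip_ee i j : ip (e i) (e j) = (i == j)%:R.
Proof. by case: he. Qed.

Lemma ip_sum_e (n m : nat) (F : nat -> R) k :
  ip (\sum_(n <= i < m) F i *: e i) (e k) = if (n <= k < m)%N then F k else 0.
Proof.
rewrite ip_suml; under eq_bigr do rewrite ipZl ip_ee mulr_natr mulrb.
by rewrite -big_mkcond/= big_nat1_eq.
Qed.

Lemma sqr_norm_sum_e (n m : nat) (F : nat -> R) :
  `|\sum_(n <= i < m) F i *: e i| ^+ 2 = \sum_(n <= i < m) F i ^+ 2.
Proof.
rewrite -hip ip_sumr; apply: eq_big_nat => k kmn.
by rewrite ipZr ip_sum_e kmn.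
Qed.

(** The partial sums are stationary from [K] on, so no bound on [c] is required; this is what lets
    the unbounded operator [sqrt_negA] be evaluated. *)
Lemma diag_op_finite c x (K : nat) :
  (forall k, (K <= k)%N -> ip x (e k) = 0) ->
  diag_op ip e c x = \sum_(0 <= k < K) (c k * ip x (e k)) *: e k.
Proof.
move=> x0; rewrite /diag_op.
apply: lim_near_cst => //.
near=> n; rewrite /series/=.
have nK : (K <= n)%N by near: n; exists K.
rewrite (big_cat_nat _ nK)//= [X in _ + X]big_nat_cond.
rewrite [X in _ + X]big1 ?addr0// => k /andP[/andP[kK _] _].
by rewrite x0// mulr0 scale0r.
Unshelve. all: by end_near. Qed.

(* The partial sums form a Cauchy sequence because their increments are
   dominated by those of the expansion of [x]. *)
Lemma diag_op_cvg c (M : R) x : (forall k, `|c k| <= M) ->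
  cvgn (series (fun k => (c k * ip x (e k)) *: e k)).
Proof.
move=> cM; have M0 : 0 <= M by apply: le_trans (cM 0%N).
have [_ /(_ x) xe] := he.
have : cvgn (series (fun k => ip x (e k) *: e k)) by apply/cvg_ex; exists x.
move=> /cvg_cauchy/cauchy_seriesP xc.
apply: cauchy_cvg; apply/cauchy_seriesP => eps eps0.
(* [M + 1] replaces [M] so that the division is legitimate when [M = 0]. *)
have eM : 0 < eps / (M + 1) by rewrite divr_gt0// ltr_wpDl.
have := xc _ eM; apply: filterS => -[n m] /= xnm.
apply: (@le_lt_trans _ _ ((M + 1) * `|\sum_(n <= k < m) ip x (e k) *: e k|)).
  rewrite -(@ler_pXn2r _ 2) ?nnegrE ?mulr_ge0 ?addr_ge0//.
  rewrite exprMn !sqr_norm_sum_e mulr_sumr ler_sum// => k _.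
  rewrite exprMn ler_wpM2r ?sqr_ge0// -real_normK ?num_real//.
  by rewrite ler_pXn2r ?nnegrE ?addr_ge0// (le_trans (cM k))// lerDl.
by rewrite mulrC -ltr_pdivlMr ?ltr_wpDl.
Qed.

(** The [k]-th coordinate of the partial sums is constant once [n > k], and [ip^~ (e k)] is
    continuous, so the value passes to the limit. *)
Lemma ip_diag_op c (M : R) x k : (forall k, `|c k| <= M) ->
  ip (diag_op ip e c x) (e k) = c k * ip x (e k).
Proof.
move=> cM; have cv := diag_op_cvg (x := x) cM.
have cvk : ip (series (fun k => (c k * ip x (e k)) *: e k) n) (e k)
    @[n --> \oo] --> ip (diag_op ip e c x) (e k).
  exact: (continuous_cvg _ (@ip_continuous (e k) _) cv).
apply: (cvg_unique _ cvk) => //; apply: cvg_near_cst.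
near=> n; rewrite /series/= ip_sum_e.
by have -> : (k < n)%N by near: n; exists k.+1.
Unshelve. all: by end_near. Qed.

End HilbertGeometry.

(** * Gaussian characters *)

Lemma measurable_fun_borel (R : realType) (H : completeNormedModType R)
    (f : H -> R) :
  continuous f -> measurable_fun [set: borel H] (f : borel H -> R).
Proof.
move=> /continuousP cf mH.
apply: (measurability _ (RGenOpens.measurableE R)) => //.
move=> _ [_ [a [b ->] <-]]; rewrite setTI.
by apply: sub_sigma_algebra; apply: cf; exact: interval_open.
Qed.

Lemma integrable_borel (R : realType) (H : completeNormedModType R)
    (mu : probability (borel H) R) (f : H -> R) (M : R) :
  continuous f -> (forall x, `|f x| <= M) ->
  mu.-integrable [set: borel H] (EFin \o (f : borel H -> R)).
Proof.
move=> cf fM; apply: measurable_bounded_integrable => //.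
- by apply: (@le_lt_trans _ _ 1%E); [exact: probability_le1|exact: ltry].
- exact: measurable_fun_borel.
- exists M; split; first by rewrite num_real.
  by move=> r Mr x _; apply: le_trans (fM x) _; exact: ltW.
Qed.

Section GaussianCharacter.
Variables (R : realType) (H : completeNormedModType R).
Variable ip : {dot H for (@idfun R)}.
Hypothesis hip : hilbert_dot ip.

(** The addition formula splits off a sine integral, which vanishes by symmetry. The phase [phi]
    lets a single formula cover sines as well, with [phi = - pi / 2]. *)
Lemma gaussian_cos (mu : probability (borel H) R) Q h phi :
  is_gaussian ip mu Q ->
  \int[mu]_x cos (phi + ip (x : H) h) =
  expR (- (2^-1 * ip (Q h) h)) * cos phi.
Proof.
move=> /(_ h)[ch sh].
have cc : continuous (fun x : H => cos (ip x h)).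
  by move=> x; apply: continuous_comp; [exact: ip_continuous|exact: continuous_cos].
have cs : continuous (fun x : H => sin (ip x h)).
  by move=> x; apply: continuous_comp; [exact: ip_continuous|exact: continuous_sin].
have ic := integrable_borel mu cc (fun x => cos_max (ip x h)).
have iS := integrable_borel mu cs (fun x => sin_max (ip x h)).
under eq_Rintegral do rewrite cosD.
rewrite RintegralB ?RintegralZl//.
- by rewrite ch sh mulr0 subr0 mulrC.
- apply: (@integrable_borel _ _ _ _ `|cos phi|) => [x|x].
    by apply: continuousM; [exact: cst_continuous|exact: cc].
  by rewrite normrM ler_piMr// cos_max.
- apply: (@integrable_borel _ _ _ _ `|sin phi|) => [x|x].
    by apply: continuousM; [exact: cst_continuous|exact: cs].
  by rewrite normrM ler_piMr// sin_max.
Qed.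

End GaussianCharacter.

(** * Smoothness of trigonometric sums *)

Section TaylorCos.
Variable R : realType.
Implicit Types u s : R.

Lemma cos_lipschitz u s : `|cos u - cos s| <= `|u - s|.
Proof.
wlog us : u s / u <= s.
  move=> hw; have [/hw//|/ltW/hw] := leP u s.
  by rewrite distrC (distrC s).
have [|c _ cE] := MVT_segment us (fun x _ => is_derive_cos x).
  by apply: continuous_subspaceT; exact: continuous_cos.
by rewrite distrC cE normrM normrN distrC ler_piMl// sin_max.
Qed.

Lemma sin_sub_id_le s : `|sin s - s| <= s ^+ 2.
Proof.
wlog s0 : s / 0 <= s.
  move=> hw; have [/hw//|/ltW s0] := leP 0 s.
  have := hw (- s); rewrite oppr_ge0 sinN sqrrN -opprD normrN; exact.
have d (x : R) : is_derive x (1 : R) (fun x : R => sin x - x) (cos x - 1).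
  exact: is_deriveB.
have [|c] := MVT_segment s0 (fun x _ => d x).
  apply: continuous_subspaceT => x.
  by apply: continuousB => //; exact: continuous_sin.
rewrite in_itv/= => /andP[c0 cs]; rewrite sin0 !subr0 => ->.
rewrite normrM (ger0_norm s0) expr2 ler_wpM2r//.
rewrite -cos0; apply: le_trans (cos_lipschitz _ _) _.
by rewrite subr0 ger0_norm.
Qed.

Lemma cos_sub1_le s : `|cos s - 1| <= s ^+ 2.
Proof.
have -> : cos s - 1 = - (sin (s / 2) ^+ 2 *+ 2).
  by rewrite [in cos s](splitr s) cosD -!expr2 cos2sin2 mulr2n; ring.
rewrite normrN ger0_norm ?mulrn_wge0 ?sqr_ge0//.
have : `|sin (s / 2)| <= `|s / 2|.
  (* Shifting by [pi / 2] turns the Lipschitz bound of the cosine into [|sin x| <= |x|]. *)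
  have := cos_lipschitz (s / 2 - pi / 2) (- (pi / 2)).
  by rewrite cosN cos_pihalf subr0 opprK subrK cosBpihalf.
rewrite -(@ler_pXn2r _ 2) ?nnegrE// !real_normK ?num_real// expr_div_n.
rewrite -mulr_natr => h; nra.
Qed.

(** The constant 2 is crude; what matters is that the bound is uniform in [u] and valid for every
    [s]. *)
Lemma cos_taylor u s : `|cos (u + s) - cos u + sin u * s| <= 2 * s ^+ 2.
Proof.
have -> : cos (u + s) - cos u + sin u * s =
    cos u * (cos s - 1) - sin u * (sin s - s) by rewrite cosD; ring.
apply: (le_trans (ler_normB _ _)); rewrite !normrM mulr2n mulrDl mul1r.
apply: lerD.
  by apply: le_trans (cos_sub1_le s); rewrite ler_piMl// cos_max.
by apply: le_trans (sin_sub_id_le s); rewrite ler_piMl// sin_max.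
Qed.

Lemma sin_taylor u s : `|sin (u + s) - sin u - cos u * s| <= 2 * s ^+ 2.
Proof.
have := cos_taylor (u - pi / 2) s.
by rewrite (addrAC u) !cosBpihalf sinBpihalf mulNr.
Qed.

End TaylorCos.

Section QuadraticRemainder.
Variables (R : realType) (V W : normedModType R).

(** The bound by [M] makes [df] continuous, the quadratic remainder is a little-o, and uniqueness of
    the differential identifies it with [df]. It serves for trigonometric sums, for their gradients
    and for the resolvent. *)
Lemma quadratic_remainder_diff (f df : V -> W) x (C M : R) :
  linear df -> (forall v, `|df v| <= M * `|v|) ->
  (forall v, `|f (v + x) - f x - df v| <= C * `|v| ^+ 2) ->
  differentiable f x /\ 'd f x = df :> (V -> W).
Proof.
move=> ldf dfM fC.
pose L : {linear V -> W} := HB.pack df (GRing.isLinear.Build R V W *:%R df ldf).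
have cdf : continuous L.
  apply/linear_bounded_continuous/linear_boundedP; exists M; split.
    by rewrite num_real.
  by move=> r Mr v; apply: (le_trans (dfM v)); rewrite ler_wpM2r// ltW.
have fo : f \o shift x = cst (f x) + L +o_ (0 : V) id.
  apply/eqaddoP => eps eps0; near=> v => /=.
  rewrite [_ v](_ : _ = f (v + x) - f x - df v); last first.
    by rewrite /= !fctE opprD addrA.
  apply: (le_trans (fC v)); rewrite expr2 mulrA ler_wpM2r//.
  apply: (@le_trans _ _ ((`|C| + 1) * `|v|)).
    by rewrite ler_wpM2r// (le_trans (ler_norm C))// lerDl.
  rewrite mulrC -ler_pdivlMr ?ltr_wpDl//.
  near: v; apply: (@cvgr0_norm_le _ _ _ (nbhs (0 : V)) _ id) => //.
  by rewrite divr_gt0// ltr_wpDl.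
have dE := diff_unique cdf fo.
by split => //; apply/diff_locallyP; rewrite dE.
Unshelve. all: by end_near. Qed.

End QuadraticRemainder.

Section TrigonometricSums.
Variables (R : realType) (H : completeNormedModType R).
Variable ip : {dot H for (@idfun R)}.
Hypothesis hip : hilbert_dot ip.

Lemma grad_eq (f : H -> R) x g :
  differentiable f x -> 'd f x = ip g :> (H -> R) -> grad ip f x = g.
Proof.
move=> df dfE; apply: xget_unique.
  by split => // v; rewrite dfE.
by move=> y [_ yE]; apply: (ip_inj hip) => v; rewrite -yE dfE.
Qed.

Lemma grad_remainder (f : H -> R) x g (C : R) :
  (forall v, `|f (v + x) - f x - ip g v| <= C * `|v| ^+ 2) ->
  differentiable f x /\ grad ip f x = g.
Proof.
move=> fC; have [//|v|d dE] := quadratic_remainder_diff (M := `|g|) _ _ fC.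
- by move=> a u v; rewrite ipDr ipZr.
- exact: Cauchy_Schwarz.
- by split => //; exact: grad_eq.
Qed.

Variables (T : Type) (p : seq T) (a : T -> R) (h : T -> H) (phi : T -> R).

(** A family of functions stable under [Pt]: the semigroup only changes the amplitudes [a] and the
    frequencies [h]. *)
Definition trig_sum (x : H) : R :=
  \sum_(m <- p) a m * cos (phi m + ip x (h m)).

Definition trig_grad (x : H) : H :=
  \sum_(m <- p) (- (a m * sin (phi m + ip x (h m)))) *: h m.

Definition trig_hess (x v : H) : H :=
  \sum_(m <- p) (- (a m * cos (phi m + ip x (h m)) * ip v (h m))) *: h m.

Lemma ip_sqr_le v w : ip v w ^+ 2 <= `|w| ^+ 2 * `|v| ^+ 2.
Proof.
rewrite -real_normK ?num_real// -exprMn ler_pXn2r ?nnegrE ?mulr_ge0//.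
by rewrite mulrC Cauchy_Schwarz.
Qed.

Lemma trig_sum_bounded x : `|trig_sum x| <= \sum_(m <- p) `|a m|.
Proof.
apply: (le_trans (ler_norm_sum _ _ _)); apply: ler_sum => m _.
by rewrite normrM ler_piMr// cos_max.
Qed.

Lemma trig_sum_remainder x v :
  `|trig_sum (v + x) - trig_sum x - ip (trig_grad x) v| <=
  (\sum_(m <- p) `|a m| * (2 * `|h m| ^+ 2)) * `|v| ^+ 2.
Proof.
rewrite ip_suml mulr_suml -!sumrB.
apply: (le_trans (ler_norm_sum _ _ _)); apply: ler_sum => m _.
rewrite ipZl ipDl (ipC _ (h m) v).
set s := ip v (h m); set u := phi m + ip x (h m).
have -> : a m * cos (phi m + (s + ip x (h m))) - a m * cos u -
    - (a m * sin u) * s = a m * (cos (u + s) - cos u + sin u * s).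
  by rewrite /u (addrC s) addrA; ring.
rewrite normrM -mulrA ler_wpM2l//; apply: le_trans (cos_taylor _ _) _.
by rewrite -mulrA ler_wpM2l// ip_sqr_le.
Qed.

Lemma grad_trig_sum x :
  differentiable trig_sum x /\ grad ip trig_sum x = trig_grad x.
Proof. exact: grad_remainder (trig_sum_remainder x). Qed.

Lemma trig_grad_bounded x : `|trig_grad x| <= \sum_(m <- p) `|a m| * `|h m|.
Proof.
apply: (le_trans (ler_norm_sum _ _ _)); apply: ler_sum => m _.
by rewrite normrZ ler_wpM2r// normrN normrM ler_piMr// sin_max.
Qed.

Lemma trig_hess_linear x : linear (trig_hess x).
Proof.
move=> c u v; rewrite /trig_hess scaler_sumr -big_split; apply: eq_bigr => m _ /=.
rewrite ipDl ipZl scalerA -scalerDl; congr (_ *: _); ring.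
Qed.

Lemma trig_hess_bounded x v :
  `|trig_hess x v| <= (\sum_(m <- p) `|a m| * `|h m| ^+ 2) * `|v|.
Proof.
rewrite mulr_suml.
apply: (le_trans (ler_norm_sum _ _ _)); apply: ler_sum => m _.
rewrite normrZ normrN 2!normrM expr2 -!mulrA ler_wpM2l//.
rewrite [leRHS](_ : _ = 1 * (`|v| * `|h m| * `|h m|)); last by ring.
by rewrite ler_pM ?mulr_ge0 ?cos_max// ler_wpM2r ?Cauchy_Schwarz.
Qed.

Lemma trig_grad_remainder x v :
  `|trig_grad (v + x) - trig_grad x - trig_hess x v| <=
  (\sum_(m <- p) `|a m| * (2 * `|h m| ^+ 2) * `|h m|) * `|v| ^+ 2.
Proof.
rewrite mulr_suml -!sumrB.
apply: (le_trans (ler_norm_sum _ _ _)); apply: ler_sum => m _.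
rewrite ipDl -!scalerBl normrZ [leRHS]mulrAC ler_wpM2r//.
set s := ip v (h m); set u := phi m + ip x (h m).
have -> : - (a m * sin (phi m + (s + ip x (h m)))) - - (a m * sin u) -
    - (a m * cos u * s) = - (a m * (sin (u + s) - sin u - cos u * s)).
  by rewrite /u (addrC s) addrA; ring.
rewrite normrN normrM -mulrA ler_wpM2l//; apply: le_trans (sin_taylor _ _) _.
by rewrite -mulrA ler_wpM2l// ip_sqr_le.
Qed.

(** This is continuity of the second derivative in operator norm, as [C2b] demands: the factor in
    front of the norm of [v] is uniform in [v]. *)
Lemma trig_hess_lipschitz x y v :
  `|trig_hess y v - trig_hess x v| <=
  (\sum_(m <- p) `|a m| * `|h m| ^+ 3) * `|y - x| * `|v|.
Proof.
rewrite !mulr_suml -!sumrB.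
apply: (le_trans (ler_norm_sum _ _ _)); apply: ler_sum => m _.
rewrite -scalerBl normrZ.
rewrite -opprD normrN.
set uy := phi m + ip y _; set ux := phi m + ip x _.
have -> : a m * cos uy * ip v (h m) + - (a m * cos ux * ip v (h m)) =
  a m * (cos uy - cos ux) * ip v (h m) by ring.
have h1 : `|cos uy - cos ux| <= `|y - x| * `|h m|.
  apply: le_trans (cos_lipschitz _ _) _.
  rewrite [uy - ux](_ : _ = ip (y - x) (h m)); first exact: Cauchy_Schwarz.
  by rewrite ipDl ipNl /uy /ux; ring.
have h2 := Cauchy_Schwarz hip v (h m).
rewrite !normrM [leRHS](_ : _ =
  `|a m| * (`|y - x| * `|h m|) * (`|v| * `|h m|) * `|h m|); last by ring.
by rewrite ler_wpM2r// ler_pM ?mulr_ge0// ler_wpM2l.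
Qed.

Lemma diff_trig_grad x :
  differentiable trig_grad x /\ 'd trig_grad x = trig_hess x :> (H -> H).
Proof.
exact: quadratic_remainder_diff (@trig_hess_linear x) (trig_hess_bounded x)
  (trig_grad_remainder x).
Qed.

Lemma C2b_trig_sum : C2b ip trig_sum.
Proof.
have gE : grad ip trig_sum = trig_grad.
  by apply/funext => x; have [] := grad_trig_sum x.
split; rewrite ?gE.
- exists (\sum_(m <- p) `|a m|); split; first by rewrite num_real.
  by move=> r Mr x _; apply: le_trans (trig_sum_bounded x) _; exact: ltW.
- by split => x; [have [] := grad_trig_sum x|have [] := diff_trig_grad x].
- split.
    exists (\sum_(m <- p) `|a m| * `|h m|); split; first by rewrite num_real.
    by move=> r Mr x _; apply: le_trans (trig_grad_bounded x) _; exact: ltW.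
  by move=> x; apply: differentiable_continuous; have [] := diff_trig_grad x.
- exists (\sum_(m <- p) `|a m| * `|h m| ^+ 2) => x v.
  by have [_ ->] := diff_trig_grad x; exact: trig_hess_bounded.
- move=> x eps eps0; set C := \sum_(m <- p) `|a m| * `|h m| ^+ 3.
  have C0 : 0 <= C by apply: sumr_ge0 => m _; rewrite mulr_ge0.
  near=> y.
  move=> v; have [_ ->] := diff_trig_grad x; have [_ ->] := diff_trig_grad y.
  apply: le_trans (trig_hess_lipschitz x y v) _; rewrite ler_wpM2r//.
  apply: (@le_trans _ _ ((C + 1) * `|y - x|)).
    by rewrite ler_wpM2r// lerDl.
  rewrite mulrC -ler_pdivlMr ?ltr_wpDl// distrC.
  near: y; apply: (@cvgr_dist_le _ _ _ (nbhs x) _ id x) => //.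
  by rewrite divr_gt0// ltr_wpDl.
Unshelve. all: by end_near. Qed.

End TrigonometricSums.

(** * Integrals against exp(-t) *)

Section ExponentialIntegral.
Variable R : realType.
Local Notation mu := (@lebesgue_measure R).

Lemma continuous_sumr (T : topologicalType) I (s : seq I) (F : I -> T -> R) :
  (forall i, continuous (F i)) -> continuous (fun x => \sum_(i <- s) F i x).
Proof.
move=> cF; elim: s => [|i s IH] x.
  under eq_fun do rewrite big_nil; exact: cst_continuous.
under eq_fun do rewrite big_cons; apply: continuousD; [exact: cF|exact: IH].
Qed.

Lemma continuous_mulr (T : topologicalType) (f g : T -> R) :
  continuous f -> continuous g -> continuous (fun x => f x * g x).
Proof. by move=> cf cg x; exact: (@continuousM R T f g x (cf x) (cg x)). Qed.

Lemma continuous_subr (T : topologicalType) (f g : T -> R) :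
  continuous f -> continuous g -> continuous (fun x => f x - g x).
Proof. by move=> cf cg x; exact: (@continuousB R _ T f g x (cf x) (cg x)). Qed.

Lemma continuous_expRM (c : R) : continuous (fun t : R => expR (t * c)).
Proof.
move=> t; apply: continuous_comp; last exact: continuous_expR.
exact: mulrr_continuous.
Qed.

(** On the half-line the integrand is dominated by [C] times the density of the exponential law of
    rate 1. *)
Lemma integrable_expRN_bounded (g : R -> R) (C : R) :
  continuous g -> (forall t, 0 <= t -> `|g t| <= C) ->
  mu.-integrable `[0, +oo[ (EFin \o (fun t => expR (- t) * g t)).
Proof.
move=> cg gC.
have ceg : continuous (fun t : R => expR (- t) * g t).
  apply: continuous_mulr => // t.
  apply: (continuous_comp (f := -%R)); last exact: continuous_expR.
  exact: opp_continuous.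
have iE : mu.-integrable `[0, +oo[ (fun t => C%:E * (exponential_pdf 1 t)%:E)%E.
  apply: integrableZl => //.
  apply: integrableS (integrable_exponential_pdf _) => //.
apply: le_integrable iE => //.
  by apply/measurable_EFinP/measurable_funTS; exact: continuous_measurable_fun.
move=> t; rewrite /= in_itv/= andbT => t0.
rewrite lee_fin /exponential_pdf patchE ifT ?inE/= ?in_itv/= ?t0//.
rewrite mul1r mulN1r !normrM mulrC ler_wpM2r//.
by rewrite (le_trans (gC t t0))// ler_norm.
Qed.

Lemma Rintegral_sum d (T : measurableType d) (nu : measure T R) (D : set T)
    I (s : seq I) (F : I -> T -> R) :
  measurable D -> (forall i, nu.-integrable D (EFin \o F i)) ->
  \int[nu]_(x in D) (\sum_(i <- s) F i x) =
  \sum_(i <- s) \int[nu]_(x in D) F i x.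
Proof.
move=> mD iF; elim: s => [|i s IH].
  under eq_Rintegral do rewrite big_nil.
  by rewrite big_nil Rintegral_cst// mul0r.
under eq_Rintegral do rewrite big_cons.
rewrite big_cons RintegralD ?IH//.
rewrite (_ : _ \o _ = fun x => (\sum_(i <- s) (F i x)%:E)%E).
  by apply: integrable_sum => // j _; exact: iF.
by apply/funext => x /=; rewrite sumEFin.
Qed.

(** Boundedness is asked only for [0 <= t], because factors such as [expR (- t * lambda k)] blow up
    at negative times. *)
Definition tame (g : R -> R) :=
  continuous g /\ exists C, forall t, 0 <= t -> `|g t| <= C.

Definition exp_int (g : R -> R) : R :=
  \int[mu]_(t in `[0, +oo[) (expR (- t) * g t).

Lemma tame_integrable g : tame g ->
  mu.-integrable `[0, +oo[ (EFin \o (fun t => expR (- t) * g t)).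
Proof. by move=> [cg [C gC]]; exact: integrable_expRN_bounded gC. Qed.

Lemma tame_cst c : tame (cst c).
Proof. by split; [move=> x; exact: cst_continuous|exists `|c|]. Qed.

Lemma tameB f g : tame f -> tame g -> tame (fun t => f t - g t).
Proof.
move=> [cf [C fC]] [cg [D gD]]; split; first exact: continuous_subr.
exists (C + D) => t t0; apply: (le_trans (ler_normB _ _)).
by rewrite lerD ?fC ?gD.
Qed.

Lemma tameM f g : tame f -> tame g -> tame (fun t => f t * g t).
Proof.
move=> [cf [C fC]] [cg [D gD]]; split; first exact: continuous_mulr.
by exists (C * D) => t t0; rewrite normrM ler_pM ?fC ?gD.
Qed.

Lemma tame_sum I (s : seq I) (F : I -> R -> R) :
  (forall i, tame (F i)) -> tame (fun t => \sum_(i <- s) F i t).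
Proof.
move=> tF; split; first by apply: continuous_sumr => i; exact: (tF i).1.
have [C FC] := choice (fun i => (tF i).2).
exists (\sum_(i <- s) C i) => t t0.
by apply: (le_trans (ler_norm_sum _ _ _)); apply: ler_sum => i _; exact: FC.
Qed.

Lemma exp_intB f g : tame f -> tame g ->
  exp_int (fun t => f t - g t) = exp_int f - exp_int g.
Proof.
move=> tf tg; rewrite -RintegralB//; [|exact: tame_integrable..].
by apply: eq_Rintegral => t _; rewrite mulrBr.
Qed.

Lemma exp_intMr f c : tame f -> exp_int (fun t => f t * c) = exp_int f * c.
Proof.
move=> tf; rewrite -RintegralZr//; last exact: tame_integrable.
by apply: eq_Rintegral => t _; rewrite mulrA.
Qed.

Lemma exp_int_sum I (s : seq I) (F : I -> R -> R) : (forall i, tame (F i)) ->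
  exp_int (fun t => \sum_(i <- s) F i t) = \sum_(i <- s) exp_int (F i).
Proof.
move=> tF; rewrite -Rintegral_sum//; last by move=> i; exact: tame_integrable.
by apply: eq_Rintegral => t _; rewrite mulr_sumr.
Qed.

(** The total mass [exp_int (cst 1)] stays unevaluated: a remainder estimate only asks for some
    finite constant. *)
Lemma le_norm_exp_int f C : tame f -> (forall t, 0 <= t -> `|f t| <= C) ->
  `|exp_int f| <= exp_int (cst 1) * C.
Proof.
move=> tf fC; rewrite -exp_intMr; last exact: tame_cst.
apply: (le_trans (le_normr_Rintegral _ (tame_integrable tf))) => //.
have i1 := tame_integrable (tameM (tame_cst 1) (tame_cst C)).
apply: le_Rintegral => //.
  have := tame_integrable tf => /(integrable_norm (mu := mu)).
  by [].
move=> t; rewrite /= in_itv/= andbT => t0.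
by rewrite normrM ger0_norm ?expR_ge0// mul1r ler_wpM2l ?expR_ge0// fC.
Qed.

(** Positivity allows discarding everything outside the window [[x, y]], on which [expR (- t)] is at
    least [expR (- y)]. *)
Lemma exp_int_ge (g : R -> R) (x y c : R) : tame g -> 0 <= x -> x <= y ->
  (forall t, 0 <= t -> 0 <= g t) ->
  (forall t, x <= t <= y -> c <= g t) -> 0 <= c ->
  expR (- y) * c * (y - x) <= exp_int g.
Proof.
move=> tg x0 xy g0 gc c0; have ig := tame_integrable tg.
have sub : `[x, y] `<=` `[0, +oo[.
  by move=> t; rewrite /= !in_itv/= andbT => /andP[xt _]; exact: le_trans xt.
have ixy : mu.-integrable `[x, y] (EFin \o (fun t => expR (- t) * g t)).
  exact: integrableS ig.
have mxy : mu `[x, y] = (y - x)%:E.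
  rewrite (lebesgue_measure_itv `[x, y])/= lte_fin.
  by move: xy; rewrite le_eqVlt => /predU1P[->|->]; rewrite ?ltxx ?subrr ?EFinB.
have mlt : (mu `[x, y] < +oo)%E by rewrite mxy ltry.
apply: (@le_trans _ _ (\int[mu]_(t in `[x, y]) (expR (- t) * g t))).
  have -> : expR (- y) * c * (y - x) = \int[mu]_(t in `[x, y]) (expR (- y) * c).
    rewrite Rintegral_cst//; congr (_ * _).
    by apply/esym; exact: (congr1 fine mxy).
  apply: le_Rintegral => //.
    by apply: measurable_bounded_integrable => //; exact: bounded_cst.
  move=> t; rewrite /= in_itv/= => /andP[xt ty].
  by rewrite ler_pM ?expR_ge0 ?ler_expR ?lerN2 ?gc ?xt.
apply: fine_le; [exact: integrable_fin_num..|].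
apply: ge0_subset_integral => //.
  by have /integrableP[] := ig.
move=> t; rewrite /= in_itv/= andbT => t0.
by rewrite lee_fin mulr_ge0 ?expR_ge0 ?g0.
Qed.

End ExponentialIntegral.

(** * The resolvent of a trigonometric sum *)

Section OrnsteinUhlenbeck.
Variables (R : realType) (H : completeNormedModType R).
Variable ip : {dot H for (@idfun R)}.
Hypothesis hip : hilbert_dot ip.
Variable e : nat -> H.
Hypothesis he : orthonormal_basis ip e.
Variable lambda : nat -> R.
Hypothesis lambda_gt0 : forall k, 0 < lambda k.
Hypothesis lambda_incr : forall i j, (i < j)%N -> lambda i < lambda j.
Variable K : nat.
Local Notation mu := (@lebesgue_measure R).

Definition comb (u : nat -> R) : H := \sum_(0 <= k < K) u k *: e k.

(** The eigenvalue of [Qt] at [e k], that is, the variance of the [k]-th coordinate under [N t]. *)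
Definition ou_var (t : R) k : R :=
  (1 - expR (- (2 * t) * lambda k)) / (2 * lambda k).

Definition ou_quad (u : nat -> R) (t : R) : R :=
  \sum_(0 <= k < K) u k ^+ 2 * ou_var t k.

Lemma ip_comb x u : ip x (comb u) = \sum_(0 <= k < K) u k * ip x (e k).
Proof. by rewrite ip_sumr; apply: eq_bigr => k _; rewrite ipZr. Qed.

Lemma expR_le1_coef t k : 0 <= t -> `|expR (- t * lambda k)| <= 1.
Proof.
move=> t0; rewrite ger0_norm ?expR_ge0// expR_le1 mulNr oppr_le0.
by rewrite mulr_ge0// ltW.
Qed.

Lemma ip_expA t x k : 0 <= t ->
  ip (expA ip e lambda t x) (e k) = expR (- t * lambda k) * ip x (e k).
Proof.
by move=> t0; apply: (ip_diag_op hip he) => // j; exact: expR_le1_coef.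
Qed.

Lemma ip_Qt t x k : 0 <= t ->
  ip (Qt ip e lambda t x) (e k) = ou_var t k * ip x (e k).
Proof.
move=> t0; rewrite /Qt /inv_neg2A.
(* As [lambda] increases, the coefficients of [inv_neg2A] are largest at index 0. *)
rewrite (@ip_diag_op _ _ _ hip _ he _ (2 * lambda 0%N)^-1); last first.
  move=> j; rewrite ger0_norm ?invr_ge0 ?mulr_ge0 ?(ltW (lambda_gt0 _))//.
  rewrite lef_pV2 ?posrE ?mulr_gt0// ler_pM2l//.
  by case: j => // j; exact/ltW/lambda_incr.
rewrite ipDl ipNl ip_expA ?mulr_ge0// /ou_var; ring.
Qed.

Lemma ou_var_ge0 t k : 0 <= t -> 0 <= ou_var t k.
Proof.
move=> t0; rewrite divr_ge0 ?mulr_ge0 ?(ltW (lambda_gt0 _))// subr_ge0.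
have := @expR_le1_coef (2 * t) k; rewrite ger0_norm ?expR_ge0//.
by apply; rewrite mulr_ge0.
Qed.

Lemma ou_quad_ge0 u t : 0 <= t -> 0 <= ou_quad u t.
Proof.
by move=> t0; apply: sumr_ge0 => k _; rewrite mulr_ge0 ?sqr_ge0 ?ou_var_ge0.
Qed.

Lemma continuous_ou_quad u : continuous (ou_quad u).
Proof.
apply: continuous_sumr => k; apply: continuous_mulr.
  by move=> t; exact: cst_continuous.
apply: continuous_mulr; last by move=> t; exact: cst_continuous.
apply: continuous_subr; first by move=> t; exact: cst_continuous.
rewrite (_ : (fun t => _) = fun t : R => expR (t * (- (2 * lambda k)))).
  exact: continuous_expRM.
by apply/funext => s; congr expR; ring.
Qed.

Lemma ip_Qt_comb u t : 0 <= t ->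
  ip (Qt ip e lambda t (comb u)) (comb u) = ou_quad u t.
Proof.
move=> t0; rewrite ip_comb; apply: eq_big_nat => k /andP[_ kK].
by rewrite ip_Qt// (ip_sum_e he) kK /=; ring.
Qed.

Lemma ip_expA_comb t x u : 0 <= t -> ip (expA ip e lambda t x) (comb u) =
  ip x (comb (fun k => expR (- t * lambda k) * u k)).
Proof.
move=> t0; rewrite !ip_comb; apply: eq_bigr => k _.
by rewrite ip_expA//; ring.
Qed.

Variable N : R -> probability (borel H) R.
Hypothesis hN : forall t, 0 <= t -> is_gaussian ip (N t) (Qt ip e lambda t).

Variables (T : Type) (p : seq T) (a : T -> R) (u : T -> nat -> R) (phi : T -> R).

Local Notation f := (trig_sum ip p a (fun m => comb (u m)) phi).
Let damped_amp t m := a m * expR (- (2^-1 * ou_quad (u m) t)).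
Let damped_freq t m := comb (fun k => expR (- t * lambda k) * u m k).

(** The Gaussian integral multiplies each amplitude by the characteristic function at its frequency,
    and [expA], being symmetric, moves from [x] onto the frequency. *)
Lemma Pt_trig_sum t x : 0 <= t ->
  Pt ip e lambda N t f x = trig_sum ip p (damped_amp t) (damped_freq t) phi x.
Proof.
move=> t0; rewrite /Pt /trig_sum.
have cc m : continuous (fun y : H =>
    cos (phi m + ip (expA ip e lambda t x + y) (comb (u m)))).
  move=> y; apply: continuous_comp; last exact: continuous_cos.
  apply: continuousD; first exact: cst_continuous.
  rewrite (_ : (fun y => _) = fun y =>
      ip (expA ip e lambda t x) (comb (u m)) + ip y (comb (u m))).
    apply: continuousD; first exact: cst_continuous.
    exact: ip_continuous.
  by apply/funext => z; rewrite ipDl.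
rewrite Rintegral_sum//; last first.
  move=> m; apply: (@integrable_borel _ _ _ _ `|a m|).
    by apply: continuous_mulr => [y|]; [exact: cst_continuous|exact: cc].
  by move=> y; rewrite normrM ler_piMr// cos_max.
apply: eq_bigr => m _; rewrite RintegralZl//; last first.
  by apply: integrable_borel (cc m) (fun y => cos_max _).
under eq_Rintegral do rewrite ipDl addrA.
rewrite (gaussian_cos hip _ _ (hN t0)) ip_Qt_comb// ip_expA_comb//.
by rewrite /damped_amp mulrA.
Qed.

(** The [k]-th coordinate of the gradient of [Pt f] at 0, stripped of the factor
    [expR (- t * lambda k)] that [grad_coef] restores. *)
Definition ou_deriv k t : R :=
  \sum_(m <- p) (- (damped_amp t m * sin (phi m))) * u m k.

Let grad_coef k t := expR (- t * lambda k) * ou_deriv k t.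

Lemma damped_amp_le t m : 0 <= t -> `|damped_amp t m| <= `|a m|.
Proof.
move=> t0; rewrite normrM ler_piMr// ger0_norm ?expR_ge0// expR_le1 oppr_le0.
by rewrite mulr_ge0 ?ou_quad_ge0.
Qed.

Lemma damped_freq_le t m : 0 <= t -> `|damped_freq t m| <= `|comb (u m)|.
Proof.
move=> t0; rewrite -(@ler_pXn2r _ 2) ?nnegrE// !(sqr_norm_sum_e hip he).
apply: ler_sum => k _; rewrite exprMn ler_piMl ?sqr_ge0//.
by rewrite -real_normK ?num_real// expr_le1// expR_le1_coef.
Qed.

Lemma continuous_damped_amp m : continuous (damped_amp ^~ m).
Proof.
apply: continuous_mulr => [t|t]; first exact: cst_continuous.
apply: continuous_comp; last exact: continuous_expR.
apply: continuousN; move: t; apply: continuous_mulr => [t|].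
  exact: cst_continuous.
exact: continuous_ou_quad.
Qed.

Lemma continuous_expRN_lambda k : continuous (fun t : R => expR (- t * lambda k)).
Proof.
rewrite (_ : (fun t => _) = fun t : R => expR (t * - lambda k)).
  exact: continuous_expRM.
by apply/funext => t; rewrite mulNr mulrN.
Qed.

Lemma continuous_grad_coef k : continuous (grad_coef k).
Proof.
apply: continuous_mulr; first exact: continuous_expRN_lambda.
apply: continuous_sumr => m; apply: continuous_mulr; last first.
  by move=> t; exact: cst_continuous.
rewrite (_ : (fun t => _) = fun t => damped_amp t m * - sin (phi m)).
  apply: continuous_mulr; first exact: continuous_damped_amp.
  by move=> t; exact: cst_continuous.
by apply/funext => t; rewrite mulrN.
Qed.

Lemma continuous_semigroup x :
  continuous (fun t => trig_sum ip p (damped_amp t) (damped_freq t) phi x).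
Proof.
apply: continuous_sumr => m; apply: continuous_mulr; first exact: continuous_damped_amp.
move=> t; apply: continuous_comp; last exact: continuous_cos.
apply: continuousD; first exact: cst_continuous.
rewrite (_ : (fun t => _) = fun t => \sum_(0 <= k < K)
    expR (- t * lambda k) * (u m k * ip x (e k))).
  move: t; apply: continuous_sumr => k; apply: continuous_mulr.
    exact: continuous_expRN_lambda.
  by move=> t; exact: cst_continuous.
apply/funext => s; rewrite ip_comb; apply: eq_bigr => k _; ring.
Qed.

Lemma grad_coef_bounded k t : 0 <= t ->
  `|grad_coef k t| <= \sum_(m <- p) `|a m| * `|u m k|.
Proof.
move=> t0; rewrite normrM -[leRHS]mul1r ler_pM ?expR_le1_coef//.
apply: (le_trans (ler_norm_sum _ _ _)); apply: ler_sum => m _.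
rewrite normrM ler_wpM2r// normrN normrM.
by apply: le_trans (damped_amp_le m t0); rewrite ler_piMr// sin_max.
Qed.

Lemma tame_grad_coef k : tame (grad_coef k).
Proof.
by split; [exact: continuous_grad_coef|eexists => t t0; exact: grad_coef_bounded t0].
Qed.

Lemma tame_semigroup x :
  tame (fun t => trig_sum ip p (damped_amp t) (damped_freq t) phi x).
Proof.
split; first exact: continuous_semigroup.
exists (\sum_(m <- p) `|a m|) => t t0.
apply: (le_trans (trig_sum_bounded _ _ _ _ _ _)).
by apply: ler_sum => m _; exact: damped_amp_le.
Qed.

Lemma ip_semigroup_grad t v :
  ip (trig_grad ip p (damped_amp t) (damped_freq t) phi 0) v =
  \sum_(0 <= k < K) grad_coef k t * ip v (e k).
Proof.
rewrite ip_suml /grad_coef /ou_deriv.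
under [RHS]eq_bigr do rewrite mulr_sumr mulr_suml.
rewrite exchange_big; apply: eq_bigr => m _ /=.
rewrite ip0l addr0 ipZl (ipC _ (damped_freq t m)) ip_comb mulr_sumr.
by apply: eq_bigr => k _; ring.
Qed.

Lemma resolvent1_trig_sum x : resolvent1 ip e lambda N f x =
  exp_int (fun t => trig_sum ip p (damped_amp t) (damped_freq t) phi x).
Proof.
apply: eq_Rintegral => t; rewrite inE/= in_itv/= andbT => t0.
by rewrite Pt_trig_sum.
Qed.

(** Differentiation passes under the time integral because the quadratic remainder is uniform in
    [t]: damping only shrinks amplitudes and frequencies, so the constant [C] of [f] itself serves
    at all times. *)
Lemma grad_resolvent1 : grad ip (resolvent1 ip e lambda N f) 0 =
  \sum_(0 <= k < K) exp_int (grad_coef k) *: e k.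
Proof.
pose C := \sum_(m <- p) `|a m| * (2 * `|comb (u m)| ^+ 2).
pose F x t := trig_sum ip p (damped_amp t) (damped_freq t) phi x.
have [|//] := @grad_remainder _ _ ip hip (resolvent1 ip e lambda N f) 0
  (\sum_(0 <= k < K) exp_int (grad_coef k) *: e k) (exp_int (cst 1) * C).
move=> v; pose S t := \sum_(0 <= k < K) grad_coef k t * ip v (e k).
have tS k : tame (fun t => grad_coef k t * ip v (e k)).
  by apply: tameM; [exact: tame_grad_coef|exact: tame_cst].
have -> : ip (\sum_(0 <= k < K) exp_int (grad_coef k) *: e k) v = exp_int S.
  rewrite ip_suml exp_int_sum//; apply: eq_bigr => k _.
  by rewrite ipZl ipC exp_intMr//; exact: tame_grad_coef.
have tF x : tame (F x) by exact: tame_semigroup.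
have tFF : tame (fun t => F v t - F 0 t) by exact: tameB.
have {}tS : tame S by exact: tame_sum.
rewrite addr0 !resolvent1_trig_sum -(exp_intB (tF v) (tF 0)) -(exp_intB tFF tS) -mulrA.
apply: le_norm_exp_int => [|t t0]; first exact: tameB.
rewrite /S -ip_semigroup_grad.
have := trig_sum_remainder hip p (damped_amp t) (damped_freq t) phi 0 v.
rewrite addr0 => /le_trans; apply; rewrite ler_wpM2r ?sqr_ge0//.
apply: ler_sum => m _; rewrite ler_pM ?mulr_ge0 ?sqr_ge0 ?damped_amp_le//.
by rewrite ler_wpM2l// ler_pXn2r ?nnegrE// damped_freq_le.
Qed.

End OrnsteinUhlenbeck.

(** * Gaussian means of trigonometric polynomials *)

Section TrigonometricPolynomials.
Variable R : realType.
Variable K : nat.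

Lemma sum_delta (F : nat -> R) k : (k < K)%N ->
  \sum_(0 <= i < K) (i == k)%:R * F i = F k.
Proof.
move=> kK; under eq_bigr do rewrite mulr_natl mulrb.
by rewrite -big_mkcond/= big_nat1_eq kK.
Qed.

(* [(a, u, phi)] encodes [y |-> a cos (phi + \sum_(k < K) u k * y k)]. *)
Definition term : Type := R * (nat -> R) * R.

Definition tm_amp (m : term) := m.1.1.
Definition tm_freq (m : term) := m.1.2.
Definition tm_phase (m : term) := m.2.

Definition tp_val (p : seq term) (y : nat -> R) : R :=
  \sum_(m <- p) tm_amp m *
    cos (tm_phase m + \sum_(0 <= k < K) tm_freq m k * y k).

Definition tm_weight (s : nat -> R) (m : term) : R :=
  tm_amp m * expR (- (2^-1 * \sum_(0 <= k < K) tm_freq m k ^+ 2 * s k)).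

(* Means of the polynomial and of its [k]-th derivative when the [y k] are
   independent centered Gaussian variables with variances [s k]. *)
Definition tp_mean (p : seq term) (s : nat -> R) : R :=
  \sum_(m <- p) tm_weight s m * cos (tm_phase m).

Definition tp_dmean (p : seq term) (s : nat -> R) (k : nat) : R :=
  \sum_(m <- p) (- (tm_weight s m * sin (tm_phase m))) * tm_freq m k.

(* The same for [\sum c cos (theta + w * y)] in a single variable [y]. *)
Definition tp1_val (q : seq (R * R * R)) (y : R) : R :=
  \sum_(n <- q) n.1.1 * cos (n.2 + n.1.2 * y).

Definition tp1_mean (q : seq (R * R * R)) (s : R) : R :=
  \sum_(n <- q) n.1.1 * expR (- (2^-1 * (n.1.2 ^+ 2 * s))) * cos n.2.

Definition tp1_dmean (q : seq (R * R * R)) (s : R) : R :=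
  \sum_(n <- q) (- (n.1.1 * expR (- (2^-1 * (n.1.2 ^+ 2 * s))) * sin n.2)) * n.1.2.

(* [cos A * cos B = (cos (A + B) + cos (A - B)) / 2]: a product of two terms is
   [tm_mul] of them plus [tm_mul] with the second argument negated. *)
Definition tm_mul (j : nat) (m : term) (c w theta : R) : term :=
  (tm_amp m * c / 2, fun k => tm_freq m k + (k == j)%:R * w, tm_phase m + theta).

Definition tp_mul (p : seq term) (j : nat) (q : seq (R * R * R)) : seq term :=
  [seq tm_mul j m n.1.1 n.1.2 n.2 | m <- p, n <- q] ++
  [seq tm_mul j m n.1.1 (- n.1.2) (- n.2) | m <- p, n <- q].

Lemma sum_tp_mul (p : seq term) j q (F : term -> R) :
  \sum_(m <- tp_mul p j q) F m = \sum_(m <- p) \sum_(n <- q)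
    (F (tm_mul j m n.1.1 n.1.2 n.2) + F (tm_mul j m n.1.1 (- n.1.2) (- n.2))).
Proof.
rewrite big_cat /= !big_allpairs_dep -big_split; apply: eq_bigr => m _.
by rewrite -big_split.
Qed.

Lemma eq_sum_all (T : Type) (P : pred T) (p : seq T) (F G : T -> R) :
  all P p -> (forall m, P m -> F m = G m) ->
  \sum_(m <- p) F m = \sum_(m <- p) G m.
Proof.
move=> + FG; elim: p => [|m p IH]; first by rewrite !big_nil.
by rewrite !big_cons => /= /andP[/FG -> /IH ->].
Qed.

Lemma lin_tm_mul j m c w theta y : (j < K)%N ->
  \sum_(0 <= k < K) tm_freq (tm_mul j m c w theta) k * y k =
  \sum_(0 <= k < K) tm_freq m k * y k + w * y j.
Proof.
move=> jK; rewrite -[w * y j](sum_delta (fun k => w * y k) jK) -big_split.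
apply: eq_bigr => k _ /=; rewrite /tm_freq/=.
by case: (k == j); rewrite ?mul1r ?mul0r ?addr0// mulrDl.
Qed.

(** Since [m] does not involve the variable [j], squaring the new frequency produces no cross term;
    this is the algebraic form of independence. *)
Lemma quad_tm_mul j m c w theta s : (j < K)%N -> tm_freq m j = 0 ->
  \sum_(0 <= k < K) tm_freq (tm_mul j m c w theta) k ^+ 2 * s k =
  \sum_(0 <= k < K) tm_freq m k ^+ 2 * s k + w ^+ 2 * s j.
Proof.
move=> jK mj.
rewrite -[w ^+ 2 * s j](sum_delta (fun k => w ^+ 2 * s k) jK) -big_split.
apply: eq_bigr => k _ /=; rewrite /tm_freq/=.
have [->|kj] := eqVneq k j; rewrite !(mul1r, mul0r) ?addr0//.
by rewrite -/(tm_freq m j) mj add0r expr0n mul0r add0r.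
Qed.

Lemma tm_weight_mul j m c w theta s : (j < K)%N -> tm_freq m j = 0 ->
  tm_weight s (tm_mul j m c w theta) =
  tm_weight s m * (c * expR (- (2^-1 * (w ^+ 2 * s j)))) / 2.
Proof.
move=> jK mj; rewrite /tm_weight quad_tm_mul// mulrDr opprD expRD.
by rewrite /tm_amp/=; ring.
Qed.

Lemma tp_val_mul p j q y : (j < K)%N ->
  tp_val (tp_mul p j q) y = tp_val p y * tp1_val q (y j).
Proof.
move=> jK; rewrite /tp_val sum_tp_mul mulr_suml; apply: eq_bigr => m _.
rewrite mulr_sumr; apply: eq_bigr => n _; rewrite !lin_tm_mul//.
rewrite /tm_amp/= /tm_phase/=; set A := \sum_(_ <= _ < _) _.
have -> : m.2 + n.2 + (A + n.1.2 * y j) = (m.2 + A) + (n.2 + n.1.2 * y j) by ring.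
rewrite mulNr.
have -> : m.2 - n.2 + (A - n.1.2 * y j) = (m.2 + A) - (n.2 + n.1.2 * y j) by ring.
by rewrite cosD cosB; field.
Qed.

(** Means of independent factors multiply: the weights factor, and the phases recombine by the
    addition formulas. *)
Lemma tp_mean_mul p j q s : (j < K)%N -> all (fun m => tm_freq m j == 0) p ->
  tp_mean (tp_mul p j q) s = tp_mean p s * tp1_mean q (s j).
Proof.
move=> jK pj; rewrite /tp_mean sum_tp_mul mulr_suml.
apply: (eq_sum_all pj) => m /eqP mj.
rewrite mulr_sumr; apply: eq_bigr => n _.
by rewrite !tm_weight_mul// sqrrN /tm_phase/= cosD cosB; field.
Qed.

(** Leibniz rule combined with independence; the derivative reaches the factor [q] only when
    [k = j]. *)
Lemma tp_dmean_mul p j q s k : (j < K)%N ->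
  all (fun m => tm_freq m j == 0) p ->
  tp_dmean (tp_mul p j q) s k =
  tp_dmean p s k * tp1_mean q (s j) +
  (k == j)%:R * (tp_mean p s * tp1_dmean q (s j)).
Proof.
move=> jK pj; rewrite /tp_dmean /tp_mean sum_tp_mul !mulr_suml mulr_sumr -big_split/=.
apply: (eq_sum_all pj) => m /eqP mj.
rewrite !mulr_sumr -big_split; apply: eq_bigr => n _ /=.
rewrite !tm_weight_mul// sqrrN /tm_phase/= sinD sinB /tm_freq/=.
by rewrite -!/(tm_freq m k); move: ((k == j)%:R : R) => b; field.
Qed.

Lemma all_freq_tp_mul p j q k : k != j ->
  all (fun m => tm_freq m k == 0) p ->
  all (fun m => tm_freq m k == 0) (tp_mul p j q).
Proof.
move=> kj; rewrite /tp_mul all_cat => pk; apply/andP.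
suff h w t : all (fun m => tm_freq m k == 0)
    [seq tm_mul j m n.1.1 (w n) (t n) | m <- p, n <- q] by split; exact: h.
elim: p pk => //= m p IH /andP[/eqP mk /IH]; rewrite all_cat => ->.
rewrite andbT all_map; apply/allT => n /=.
by rewrite /tm_freq/= (negbTE kj) mul0r addr0 -/(tm_freq m k) mk.
Qed.

Lemma tp_val_cat p q y : tp_val (p ++ q) y = tp_val p y + tp_val q y.
Proof. by rewrite /tp_val big_cat. Qed.

Lemma tp_dmean_cat p q s k :
  tp_dmean (p ++ q) s k = tp_dmean p s k + tp_dmean q s k.
Proof. by rewrite /tp_dmean big_cat. Qed.

End TrigonometricPolynomials.

(** * The lacunary polynomial *)

Section LacunaryPolynomial.
Variable R : realType.
Implicit Types w s : R.

(* sin^3 (w y) = 3/4 sin (w y) - 1/4 sin (3 w y) *)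
Definition sin_cube w : seq (R * R * R) :=
  [:: (3 / 4, w, - (pi / 2)); (- (1 / 4), 3 * w, - (pi / 2))].

(* cos^2 (w y) = 1/2 + 1/2 cos (2 w y) *)
Definition cos_sqr w : seq (R * R * R) := [:: (1 / 2, 0, 0); (1 / 2, 2 * w, 0)].

Lemma tp1_val_sin_cube w (y : R) : tp1_val (sin_cube w) y = sin (w * y) ^+ 3.
Proof.
rewrite /tp1_val !big_cons big_nil /= !(addrC (- (pi / 2))) !cosBpihalf -mulrA.
set x := w * y.
have -> : 3 * x = x + x + x by ring.
rewrite !sinD cosD.
have c2 : cos x ^+ 2 = 1 - sin x ^+ 2 by rewrite -(cos2Dsin2 x) addrK.
have -> : (sin x * cos x + cos x * sin x) * cos x = 2 * sin x * cos x ^+ 2 by ring.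
have -> : cos x * cos x = cos x ^+ 2 by ring.
by rewrite c2; field.
Qed.

Lemma tp1_val_cos_sqr w (y : R) : tp1_val (cos_sqr w) y = cos (w * y) ^+ 2.
Proof.
rewrite /tp1_val !big_cons big_nil /= mul0r !add0r cos0 -mulrA.
have -> : 2 * (w * y) = w * y + w * y by ring.
have s2 : sin (w * y) ^+ 2 = 1 - cos (w * y) ^+ 2.
  by rewrite -(cos2Dsin2 (w * y)) addrC addKr.
by rewrite cosD -!expr2 s2; field.
Qed.

Lemma tp1_mean_cos_sqr w s :
  tp1_mean (cos_sqr w) s = 1 / 2 + 1 / 2 * expR (- (2 * (w ^+ 2 * s))).
Proof.
rewrite /tp1_mean !big_cons big_nil /= cos0 addr0 expr0n mul0r mulr0 oppr0 expR0.
by rewrite !mulr1; congr (_ + _ * expR _); field.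
Qed.

Lemma tp1_dmean_cos_sqr w s : tp1_dmean (cos_sqr w) s = 0.
Proof.
by rewrite /tp1_dmean !big_cons big_nil /= sin0 !mulr0 oppr0 !mul0r !addr0.
Qed.

(** The frequencies [w] and [3 * w] contribute with opposite signs and equal size, [3 / 4 * w] and
    [1 / 4 * (3 * w)]. Hence the value is 0 at [s = 0], and for [w > 0] it is positive when
    [s > 0]. *)
Lemma tp1_dmean_sin_cube w s : tp1_dmean (sin_cube w) s =
  3 / 4 * w * (expR (- (w ^+ 2 * s / 2)) - expR (- (9 * (w ^+ 2 * s) / 2))).
Proof.
rewrite /tp1_dmean !big_cons big_nil /= sinN sin_pihalf.
have -> : - (2^-1 * (w ^+ 2 * s)) = - (w ^+ 2 * s / 2) by field.
have -> : - (2^-1 * ((3 * w) ^+ 2 * s)) = - (9 * (w ^+ 2 * s) / 2) by field.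
by field.
Qed.

Variables (K : nat) (kap : nat -> nat) (om : nat -> R).
Hypothesis kap_inj : injective kap.

Fixpoint cos_prod i : seq (term R) :=
  if i is j.+1 then tp_mul (cos_prod j) (kap j) (cos_sqr (om j))
  else [:: (1, fun=> 0, 0)].

Fixpoint lac_poly n : seq (term R) :=
  if n is j.+1 then lac_poly j ++ tp_mul (cos_prod j) (kap j) (sin_cube (om j))
  else [::].

Lemma cos_prod_freq i k : (forall j, (j < i)%N -> k != kap j) ->
  all (fun m => tm_freq m k == 0) (cos_prod i).
Proof.
elim: i => [_|i IH ki] /=; first by rewrite eqxx.
by apply: all_freq_tp_mul; [exact: ki|apply: IH => j ji; exact/ki/ltnW].
Qed.

Lemma cos_prod_fresh i : all (fun m => tm_freq m (kap i) == 0) (cos_prod i).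
Proof.
apply: cos_prod_freq => j ji; apply/eqP => /kap_inj ij.
by rewrite ij ltnn in ji.
Qed.

Lemma cos_prod_val_itv i y : (forall j, (j < i)%N -> (kap j < K)%N) ->
  0 <= tp_val K (cos_prod i) y <= 1.
Proof.
elim: i y => [|i IH] y kK /=.
  rewrite /tp_val big_seq1 /tm_amp/= /tm_freq /tm_phase/=.
  under eq_bigr do rewrite mul0r.
  by rewrite big1_eq addr0 cos0 mulr1 lexx ler01.
rewrite tp_val_mul ?kK// tp1_val_cos_sqr.
have /andP[g0 g1] := IH y (fun j ji => kK j (ltnW ji)).
by rewrite mulr_ge0 ?sqr_ge0//= mulr_ile1 ?sqr_ge0.
Qed.

(** Induction on the telescoping invariant: with [g] the current cosine product, the new summand is
    at most [g * (1 - cos x ^+ 2)], which is exactly the decrease of the product. *)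
Lemma lac_poly_val_le n y : (forall j, (j < n)%N -> (kap j < K)%N) ->
  `|tp_val K (lac_poly n) y| <= 1 - tp_val K (cos_prod n) y.
Proof.
elim: n y => [|n IH] y kK.
  rewrite /tp_val big_nil normr0 subr_ge0.
  by have /andP[] := @cos_prod_val_itv 0 y kK.
have kn : forall j, (j < n)%N -> (kap j < K)%N by move=> j jn; exact/kK/ltnW.
have /andP[g0 g1] := cos_prod_val_itv y kn.
rewrite /= tp_val_cat !tp_val_mul ?kK//.
rewrite tp1_val_sin_cube tp1_val_cos_sqr.
apply: (le_trans (ler_normD _ _)); have {}IH := IH y kn.
rewrite normrM (ger0_norm g0); set g := tp_val K _ _ in IH g0 g1 *.
set x := om n * _.
(* The cube is dominated by [sin x ^+ 2], because [|sin x| <= 1]. *)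
have sx : `|sin x ^+ 3| <= 1 - cos x ^+ 2.
  rewrite -[X in X - _](cos2Dsin2 x) addrAC subrr add0r normrX -real_normK ?num_real//.
  by rewrite exprS ler_piMl ?sqr_ge0// sin_max.
apply: (le_trans (lerD IH (ler_wpM2l g0 sx))).
by rewrite le_eqVlt; apply/orP; left; apply/eqP; ring.
Qed.

Lemma cos_prod_mean i v : (forall j, (j < i)%N -> (kap j < K)%N) ->
  tp_mean K (cos_prod i) v =
  \prod_(0 <= j < i) tp1_mean (cos_sqr (om j)) (v (kap j)).
Proof.
elim: i => [|i IH] kK /=.
  rewrite big_geq// /tp_mean big_seq1 /tm_weight /tm_amp /tm_freq /tm_phase/=.
  under eq_bigr do rewrite expr0n mul0r.
  by rewrite big1_eq mulr0 oppr0 expR0 cos0 !mulr1.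
rewrite tp_mean_mul ?kK ?cos_prod_fresh// big_nat_recr//= IH//.
by move=> j ji; exact/kK/ltnW.
Qed.

Lemma cos_prod_dmean i v k : (forall j, (j < i)%N -> (kap j < K)%N) ->
  tp_dmean K (cos_prod i) v k = 0.
Proof.
elim: i => [|i IH] kK /=.
  by rewrite /tp_dmean big_seq1 /tm_phase/= sin0 !mulr0.
rewrite tp_dmean_mul ?kK ?cos_prod_fresh// tp1_dmean_cos_sqr !mulr0 addr0.
by rewrite IH ?mul0r// => j ji; exact/kK/ltnW.
Qed.

(** In a summand [j != i] the derivative can only fall on the cosine product, whose derivative has
    mean 0 by parity; in the summand [i] it falls on the sine cube. *)
Lemma lac_poly_dmean n v i : (forall j, (j < n)%N -> (kap j < K)%N) ->
  (i < n)%N -> tp_dmean K (lac_poly n) v (kap i) =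
  tp_mean K (cos_prod i) v * tp1_dmean (sin_cube (om i)) (v (kap i)).
Proof.
move=> kK; have stepE j : (j < n)%N ->
    tp_dmean K (tp_mul (cos_prod j) (kap j) (sin_cube (om j))) v (kap i) =
    (i == j)%:R * (tp_mean K (cos_prod i) v * tp1_dmean (sin_cube (om i)) (v (kap i))).
  move=> jn; rewrite tp_dmean_mul ?kK ?cos_prod_fresh// cos_prod_dmean; last first.
    by move=> l lj; exact/kK/(ltn_trans lj).
  by rewrite mul0r add0r (inj_eq kap_inj); case: eqVneq => [->|]; rewrite ?mul0r.
(* The induction runs over partial sums, and the indicator of [i < l] records whether the [i]-th
   summand has already been added. *)
suff h l : (l <= n)%N -> tp_dmean K (lac_poly l) v (kap i) =
    (i < l)%:R * (tp_mean K (cos_prod i) v * tp1_dmean (sin_cube (om i)) (v (kap i))).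
  by move=> ile; rewrite h// ile mul1r.
elim: l => [_|l IH ln] /=; first by rewrite /tp_dmean big_nil mul0r.
rewrite tp_dmean_cat (IH (ltnW ln)) stepE// -mulrDl; congr (_ * _).
by rewrite ltnS; case: ltngtP => _; rewrite ?addr0 ?add0r.
Qed.

End LacunaryPolynomial.

(** * Lacunary subsequences and lower bounds on the time window *)

Section Lacunary.
Variable R : realType.

(** Weierstrass product inequality; the bounds by 0 and 1 are carried along because the induction
    step uses them. *)
Lemma prod_ge_1_sub_sum n (f x : nat -> R) :
  (forall j, (j < n)%N -> 0 <= f j <= 1 /\ 1 - x j <= f j) ->
  0 <= \prod_(0 <= j < n) f j <= 1 /\
  1 - \sum_(0 <= j < n) x j <= \prod_(0 <= j < n) f j.
Proof.
elim: n => [|n IH] fx; first by rewrite !big_geq// subr0 lexx ler01.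
have [|/andP[p0 p1] px] := IH; first by move=> j jn; exact/fx/ltnW.
have [//|/andP[f0 f1] fxn] := fx n.
rewrite !big_nat_recr//=; split; first by rewrite mulr_ge0//= mulr_ile1.
nra.
Qed.

Variable lambda : nat -> R.
Hypothesis lambda_gt0 : forall k, 0 < lambda k.
Hypothesis lambda_incr : forall i j, (i < j)%N -> lambda i < lambda j.

Lemma lacunary_subsequence :
  lambda k / (k.+1%:R ^+ 2) @[k --> \oo] --> (1 : R) ->
  exists kap : nat -> nat,
    {homo kap : i j / (i < j)%N} /\
    forall i, 5 * lambda (kap i) <= lambda (kap i.+1).
Proof.
move=> sim.
have next k : exists l, (k < l)%N /\ 5 * lambda k <= lambda l.
  have /cvgr_ge/(_ (2^-1)) h := sim.
  have [|n0 _ n0P] := h; first by rewrite invf_lt1// ltr1n.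
  (* Eventually [lambda l] is at least half of the square of [l.+1], so [l.+1 >= M] gives
     [lambda l >= M / 2 = 5 * lambda k]. *)
  set M := 10 * lambda k.
  pose l := maxn n0 (maxn k.+1 (Num.bound M)); exists l; split.
    exact: leq_trans (leq_maxl _ _) (leq_maxr _ _).
  have := n0P l (leq_maxl _ _); rewrite /= ler_pdivlMr ?exprn_gt0// => hl.
  have Ml : M <= l.+1%:R.
    have M0 : 0 <= M by rewrite mulr_ge0// ltW.
    apply: ltW; apply: lt_le_trans (archi_boundP M0) _; rewrite ler_nat leqW//.
    exact: leq_trans (leq_maxr _ _) (leq_maxr _ _).
  apply: le_trans hl; rewrite -[5 * _](_ : 2^-1 * M = _); last by rewrite /M; field.
  rewrite ler_wpM2l//.
  by apply: le_trans Ml _; rewrite expr2 ler_peMr// ler1n.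
have [nx nxP] := choice next.
exists (fun i => iter i nx 0%N); split; last by move=> i; exact: (nxP _).2.
by apply: homo_ltn => [|i]; [exact: ltn_trans|exact: (nxP _).1].
Qed.

Variable kap : nat -> nat.
Hypothesis kap_lac : forall i, 5 * lambda (kap i) <= lambda (kap i.+1).

(** Adding a term turns the bound into 5/4 of [lambda (kap i)], and the ratio 5 converts this into a
    quarter of the next value. *)
Lemma sum_lacunary_le i :
  \sum_(0 <= j < i) lambda (kap j) <= lambda (kap i) / 4.
Proof.
elim: i => [|i IH]; first by rewrite big_geq// divr_ge0// ltW.
by rewrite big_nat_recr//=; have := kap_lac i; lra.
Qed.

Hypothesis kap_homo : {homo kap : i j / (i < j)%N}.

Local Notation om := (fun i => Num.sqrt (lambda (kap i))).

(** This is the variance of [theta_i] under [N t]. The scaling by [om i] makes it a function of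
    [t * lambda (kap i)] alone. *)
Lemma om_ou_var t i : om i ^+ 2 * ou_var lambda t (kap i) =
  (1 - expR (- (2 * t) * lambda (kap i))) / 2.
Proof.
rewrite sqr_sqrtr ?(ltW (lambda_gt0 _))// /ou_var.
by field; exact: lt0r_neq0.
Qed.

Lemma kap_inj : injective kap.
Proof.
move=> i j ij; apply/eqP; case: ltngtP => // /kap_homo; by rewrite ij ltnn.
Qed.

Local Notation sig t i := ((1 - expR (- (2 * t) * lambda (kap i))) / 2).

Lemma sig_itv t i : 0 <= t -> 0 <= sig t i <= 1 / 2.
Proof.
move=> t0.
have : expR (- (2 * t) * lambda (kap i)) <= 1.
  by rewrite expR_le1 mulNr oppr_le0 !mulr_ge0// ltW.
have := expR_ge0 (- (2 * t) * lambda (kap i)); lra.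
Qed.

Lemma sig_le t i : sig t i <= t * lambda (kap i).
Proof. have := expR_ge1Dx (- (2 * t) * lambda (kap i)); lra. Qed.

(** Factor out [expR (- (9 * x / 2))], which is smallest at [x = 1 / 2] with value
    [expR (- (9 / 4))], and use [expR (4 * x) - 1 >= 4 * x]. *)
Lemma exp_gap (x : R) : 0 <= x <= 1 / 2 ->
  expR (- (9 / 4)) * (4 * x) <= expR (- (x / 2)) - expR (- (9 * x / 2)).
Proof.
move=> /andP[x0 x1].
have -> : - (x / 2) = - (9 * x / 2) + 4 * x by field.
rewrite expRD.
have h1 := expR_ge1Dx (4 * x).
have h2 : expR (- (9 / 4)) <= expR (- (9 * x / 2)) by rewrite ler_expR; lra.
have h3 := expR_ge0 (- (9 / 4) : R).
nra.
Qed.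

(** A squared cosine of a Gaussian of variance [x] has mean [(1 + expR (- (2 * x))) / 2 >= 1 - x],
    and here [x <= t * lambda (kap j)]. *)
Lemma cos_prod_mean_itv K i t : 0 <= t ->
  (forall j, (j < i)%N -> (kap j < K)%N) ->
  0 <= tp_mean K (cos_prod kap om i) (ou_var lambda t) <= 1 /\
  1 - \sum_(0 <= j < i) t * lambda (kap j) <=
  tp_mean K (cos_prod kap om i) (ou_var lambda t).
Proof.
move=> t0 kK; rewrite (cos_prod_mean _ kap_inj)//.
apply: prod_ge_1_sub_sum => j _; rewrite tp1_mean_cos_sqr om_ou_var.
have /andP[s0 s1] := sig_itv j t0; have s2 := sig_le t j.
set x := sig t j in s0 s1 s2 *.
have h1 := expR_ge1Dx (- (2 * x)).
have h2 : expR (- (2 * x)) <= 1 by rewrite expR_le1; lra.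
have h3 := expR_ge0 (- (2 * x)).
by split; [apply/andP; split|]; lra.
Qed.

(** The product of the bounds on the window: [expR (- 2)] for the semigroup factor, 1/2 for the
    cosine product, 3/4 from the sine cube, and the bound of [exp_gap] at the smallest variance
    [(1 - expR (- 2)) / 2]. *)
Definition lac_const : R :=
  expR (- 2) * (1 / 2 * (3 / 4 * (expR (- (9 / 4)) * (2 * (1 - expR (- 2)))))).

Lemma lac_const_gt0 : 0 < lac_const.
Proof.
have : expR (- 2) < 1 :> R by rewrite expR_lt1; lra.
by move=> h; rewrite !mulr_gt0 ?expR_gt0// subr_gt0.
Qed.

Lemma lac_integrand_ge0 K i t : 0 <= t ->
  (forall j, (j < i)%N -> (kap j < K)%N) ->
  0 <= expR (- t * lambda (kap i)) *
    (tp_mean K (cos_prod kap om i) (ou_var lambda t) *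
     tp1_dmean (sin_cube (om i)) (ou_var lambda t (kap i))).
Proof.
move=> t0 kK; have [/andP[m0 _] _] := cos_prod_mean_itv t0 kK.
rewrite mulr_ge0 ?expR_ge0// mulr_ge0// tp1_dmean_sin_cube om_ou_var.
have sI := sig_itv i t0; have /andP[s0 _] := sI.
rewrite !mulr_ge0 ?sqrtr_ge0//; apply: le_trans (exp_gap sI).
by rewrite mulr_ge0 ?expR_ge0// mulr_ge0.
Qed.

Lemma lac_integrand_ge K i t :
  1 / lambda (kap i) <= t <= 2 / lambda (kap i) ->
  (forall j, (j < i)%N -> (kap j < K)%N) ->
  lac_const * om i <= expR (- t * lambda (kap i)) *
    (tp_mean K (cos_prod kap om i) (ou_var lambda t) *
     tp1_dmean (sin_cube (om i)) (ou_var lambda t (kap i))).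
Proof.
have l0 := lambda_gt0 (kap i).
rewrite ler_pdivrMr// ler_pdivlMr// => /andP[t1 t2] kK.
have t0 : 0 <= t by rewrite -(pmulr_lge0 _ l0); apply: le_trans t1.
have [_] := cos_prod_mean_itv t0 kK.
rewrite -mulr_sumr => m1.
(* The slower modes cost at most [t * lambda (kap i) / 4], and the right end of the window keeps
   this below 1/2. *)
have {m1} m2 : 1 / 2 <= tp_mean K (cos_prod kap om i) (ou_var lambda t).
  apply: le_trans m1; have S := sum_lacunary_le i; nra.
have sI := sig_itv i t0; have gap := exp_gap sI.
(* The left end of the window, [1 <= t * lambda (kap i)], is what keeps the variance away from 0. *)
have s1 : (1 - expR (- 2)) / 2 <= sig t i.
  have : expR (- (2 * t) * lambda (kap i)) <= expR (- 2) by rewrite ler_expR; lra.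
  lra.
have e2 : expR (- 2) <= expR (- t * lambda (kap i)) by rewrite ler_expR; lra.
have e1 : expR (- 2) < 1 :> R by rewrite expR_lt1; lra.
rewrite tp1_dmean_sin_cube om_ou_var.
have d1 : expR (- (9 / 4)) * (2 * (1 - expR (- 2))) <=
    expR (- (sig t i / 2)) - expR (- (9 * sig t i / 2)).
  apply: le_trans gap; rewrite ler_wpM2l ?expR_ge0//; lra.
have p1 : 0 <= expR (- (9 / 4)) * (2 * (1 - expR (- 2))) :> R.
  by rewrite !mulr_ge0 ?expR_ge0// subr_ge0 ltW.
set Y := _ * _ in d1 p1.
have -> : lac_const * om i = expR (- 2) * (1 / 2 * (3 / 4 * om i * Y)).
  by rewrite /lac_const -/Y; ring.
have q0 : 0 <= 3 / 4 * om i by rewrite mulr_ge0 ?sqrtr_ge0.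
by rewrite !ler_pM ?ler_wpM2l ?mulr_ge0 ?expR_ge0.
Qed.

End Lacunary.

(** * The resolvent of the lacunary function *)

Section LacunaryResolvent.
Variables (R : realType) (H : completeNormedModType R).
Variable ip : {dot H for (@idfun R)}.
Hypothesis hip : hilbert_dot ip.
Variable e : nat -> H.
Hypothesis he : orthonormal_basis ip e.
Variable lambda : nat -> R.
Hypothesis lambda_gt0 : forall k, 0 < lambda k.
Hypothesis lambda_incr : forall i j, (i < j)%N -> lambda i < lambda j.
Variable N : R -> probability (borel H) R.
Hypothesis hN : forall t, 0 <= t -> is_gaussian ip (N t) (Qt ip e lambda t).
Variable kap : nat -> nat.
Hypothesis kap_lac : forall i, 5 * lambda (kap i) <= lambda (kap i.+1).
Hypothesis kap_homo : {homo kap : i j / (i < j)%N}.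

Local Notation om := (fun i => Num.sqrt (lambda (kap i))).

(** Truncating at [kap n] modes loses nothing: the frequencies used are [kap j] with [j < n], all
    below [kap n]. *)
Definition lac_fun n : H -> R :=
  trig_sum ip (lac_poly kap om n)
    (@tm_amp R) (fun m => comb e (kap n) (tm_freq m)) (@tm_phase R).

Lemma lac_fun_le1 n x : `|lac_fun n x| <= 1.
Proof.
have kK j : (j < n)%N -> (kap j < kap n)%N by exact: kap_homo.
have -> : lac_fun n x = tp_val (kap n)
    (lac_poly kap om n) (fun k => ip x (e k)).
  by apply: eq_bigr => m _; rewrite ip_comb.
apply: le_trans (lac_poly_val_le _ _ kK) _.
by rewrite gerDl oppr_le0; have /andP[] := cos_prod_val_itv om (fun k => ip x (e k)) kK.
Qed.

Lemma sum_subsequence_le (F : nat -> R) n : (forall k, 0 <= F k) ->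
  \sum_(0 <= i < n) F (kap i) <= \sum_(0 <= k < kap n) F k.
Proof.
move=> F0; elim: n => [|n IH]; first by rewrite big_geq// sumr_ge0.
have kn : (kap n < kap n.+1)%N by exact: kap_homo.
rewrite big_nat_recr//= (big_cat_nat (leq0n _) (ltnW kn))//=.
rewrite lerD// big_ltn// lerDl sumr_ge0//.
Qed.

(** All windows end before [2 / lambda 0], so the first factor bounds [expR (- t)] from below on
    each of them, independently of [i] and [n]. *)
Definition grad_const : R := expR (- (2 / lambda 0%N)) * lac_const R.

Lemma sqrt_lambda_exp_int_ge n i (g : R -> R) : (i < n)%N ->
  g = (fun t => expR (- t * lambda (kap i)) * ou_deriv lambda (kap n)
     (lac_poly kap om n)
     (@tm_amp R) (@tm_freq R) (@tm_phase R) (kap i) t) ->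
  grad_const <= Num.sqrt (lambda (kap i)) * exp_int g.
Proof.
move=> ni gE.
have kK j : (j < n)%N -> (kap j < kap n)%N by exact: kap_homo.
have kKi j : (j < i)%N -> (kap j < kap n)%N.
  by move=> ji; exact/kK/(ltn_trans ji).
have tg : tame g by rewrite gE; exact: tame_grad_coef.
have l0 := lambda_gt0 (kap i).
have gE' t : g t = expR (- t * lambda (kap i)) *
    (tp_mean (kap n) (cos_prod kap om i) (ou_var lambda t) *
     tp1_dmean (sin_cube (Num.sqrt (lambda (kap i)))) (ou_var lambda t (kap i))).
  rewrite gE; congr (_ * _).
  (* [ou_deriv] is by computation [tp_dmean] at the variances [ou_var lambda t]. *)
  exact: (lac_poly_dmean _ (kap_inj kap_homo) (ou_var lambda t) kK ni).
have x0 : 0 <= 1 / lambda (kap i) by rewrite divr_ge0// ltW.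
have xy : 1 / lambda (kap i) <= 2 / lambda (kap i).
  by rewrite ler_wpM2r ?invr_ge0 ?(ltW l0)// ler1n.
have := @exp_int_ge _ g _ _ (lac_const R * Num.sqrt (lambda (kap i))) tg x0 xy.
move=> h; apply: le_trans (ler_wpM2l (sqrtr_ge0 _) (h _ _ _)).
(* The window has length [1 / lambda (kap i)], which cancels the two square roots, one from
   [sqrt_negA] and one from the size of the derivative. *)
- rewrite [leRHS](_ : _ = expR (- (2 / lambda (kap i))) * lac_const R *
      (Num.sqrt (lambda (kap i)) ^+ 2 / lambda (kap i))); last by ring.
  rewrite sqr_sqrtr ?(ltW l0)// divff ?lt0r_neq0// mulr1.
  rewrite ler_wpM2r ?(ltW (lac_const_gt0 _))// ler_expR lerN2.
  rewrite ler_wpM2l// lef_pV2 ?posrE//.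
  by case: (kap i) => // k; exact/ltW/lambda_incr.
- by move=> t t0; rewrite gE'; exact: lac_integrand_ge0.
- by move=> t t12; rewrite gE'; exact: lac_integrand_ge.
- by rewrite mulr_ge0 ?sqrtr_ge0// ltW// lac_const_gt0.
Qed.

(** By Parseval the squared norm is a sum over modes; only the modes [kap i] with [i < n] are kept,
    and each contributes at least [grad_const ^+ 2]. *)
Lemma sqr_norm_grad_ge n : n%:R * grad_const ^+ 2 <=
  `|sqrt_negA ip e lambda (grad ip (resolvent1 ip e lambda N (lac_fun n)) 0)| ^+ 2.
Proof.
rewrite (grad_resolvent1 hip he lambda_gt0 lambda_incr _ hN).
set g := \sum_(_ <= _ < _) _.
rewrite /sqrt_negA (@diag_op_finite _ _ ip e _ g (kap n)); last first.
  by move=> k kK; rewrite (ip_sum_e he) /= ltnNge kK.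
rewrite (sqr_norm_sum_e hip he).
apply: le_trans (@sum_subsequence_le
  (fun k => (Num.sqrt (lambda k) * ip g (e k)) ^+ 2) n (fun=> sqr_ge0 _)).
rewrite [leLHS](_ : _ = \sum_(0 <= i < n) grad_const ^+ 2); last first.
  by rewrite sumr_const_nat subn0 mulr_natl.
apply: ler_sum_nat => i /andP[_ ni].
have c0 : 0 <= grad_const by rewrite mulr_ge0 ?expR_ge0// ltW// lac_const_gt0.
have ci := sqrt_lambda_exp_int_ge ni erefl.
by rewrite (ip_sum_e he) /= kap_homo// ler_pXn2r ?nnegrE// (le_trans c0 ci).
Qed.

End LacunaryResolvent.

(* Indices are shifted by one: e k and lambda k stand for e_{k+1} and
   lambda_{k+1}. N t is the Gaussian measure N(0, Q_t). *)
Theorem corollary2p3 (R : realType) (H : completeNormedModType R)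
    (ip : {dot H for (@idfun R)}) (hip : hilbert_dot ip)
    (e : nat -> H) (he : orthonormal_basis ip e)
    (lambda : nat -> R)
    (lambda_gt0 : forall k, 0 < lambda k)
    (lambda_incr : forall i j, (i < j)%N -> lambda i < lambda j)
    (lambda_sim : lambda k / (k.+1%:R ^+ 2) @[k --> \oo] --> (1 : R))
    (N : R -> probability (borel H) R)
    (hN : forall t, 0 <= t -> is_gaussian ip (N t) (Qt ip e lambda t)) :
  ereal_sup [set (`|sqrt_negA ip e lambda
                      (grad ip (resolvent1 ip e lambda N f) 0)|)%:E
            | f in [set f : H -> R | C2b ip f /\ (sup_norm f <= 1%E)%E] ]
  = +oo%E.
Proof.
have [kap [kap_homo kap_lac]] :=
  lacunary_subsequence lambda_gt0 lambda_sim.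
apply/eqyP => M M0.
have C0 : 0 < grad_const lambda ^+ 2.
  by rewrite exprn_gt0// mulr_gt0 ?expR_gt0 ?lac_const_gt0.
(* Enough modes for the squared norm to exceed [M ^+ 2]. *)
pose n := Num.bound (M ^+ 2 / grad_const lambda ^+ 2).
have nM : M ^+ 2 <= n%:R * grad_const lambda ^+ 2.
  by rewrite -ler_pdivrMr// ltW// archi_boundP// divr_ge0// ?sqr_ge0// ltW.
apply: le_trans (ereal_sup_ubound _); last first.
  exists (lac_fun ip e lambda kap n) => //; split; first exact: C2b_trig_sum.
  apply: ge_ereal_sup => _ [x _ <-]; rewrite lee_fin; exact: lac_fun_le1.
rewrite lee_fin -(@ler_pXn2r _ 2) ?nnegrE//; last exact: ltW.
exact: le_trans nM (sqr_norm_grad_ge hip he lambda_gt0 lambda_incr hN kap_lac kap_homo n).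
Qed.
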